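(* There is an absolute constant $C$ such that for all positive integers $k,m$ and every $km\times km$ sum-decomposable permutation matrix $P=P_1\oplus\cdots\oplus P_m$ in which each block $P_i$ is a $k\times k$ permutation matrix, the Ramsey number of the ordered graph $\mathcal G_P$ satisfies $$R(\mathcal G_P)\le 2^{Ck}\,m .$$ (That is, the Ramsey number of $\mathcal G_P$ is $2^{O(k)}m$.)
   Context: An ordered graph is a finite simple graph with a linear ordering of its vertices. An ordered graph $\mathcal H$ is contained in (has a copy in) $\mathcal G$ if there is an order-preserving injection from the vertices of $\mathcal H$ to the vertices of $\mathcal G$ that maps edges to edges. $R(\mathcal G)$ is the minimum $N$ such that every 2-coloring of the edges of the complete ordered graph on $N$ vertices contains a monochromatic copy of $\mathcal G$. For an $a\times b$ 0-1 matrix $P$, $\mathcal G_P$ is the ordered graph on $a+b$ vertices $u_1<\dots<u_a<w_1<\dots<w_b$ with edge set $\{u_iw_j: P(i,j)=1\}$. The direct sum of matrices $A$ and $B$ is the block matrix $A\oplus B=\begin{pmatrix}0&B\\ A&0\end{pmatrix}$. A permutation matrix is sum-decomposable if it is a direct sum of permutation matrices, which are called its blocks. *)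

(* Defs.v *)
From mathcomp Require Import all_boot all_order all_fingroup all_algebra.

Set Implicit Arguments.
Unset Strict Implicit.
Unset Printing Implicit Defensive.

(* The linearly ordered vertex set is taken to be 'I_n with its usual order. *)
Record ordered_graph (n : nat) := OrderedGraph {
  edge :> rel 'I_n;
  edge_sym : symmetric edge;
  edge_irr : irreflexive edge
}.

Definition contains (h g : nat) (H : ordered_graph h) (G : ordered_graph g) :
    bool :=
  [exists f : {ffun 'I_h -> 'I_g},
    [&& injectiveb f,
        [forall x : 'I_h, forall y : 'I_h, (x <= y) ==> (f x <= f y)]
      & [forall x, forall y, H x y ==> G (f x) (f y)]]].

(* The edges of the complete graph are the pairs [set x; y] with x != y; the
   values of a coloring on other subsets are never used. *)
Definition coloring (N : nat) := {ffun {set 'I_N} -> bool}.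

Definition color_rel (N : nat) (c : coloring N) (b : bool) : rel 'I_N :=
  fun x y => (x != y) && (c [set x; y] == b).

Lemma color_rel_sym N (c : coloring N) b : symmetric (color_rel c b).
Proof. by move=> x y; rewrite /color_rel eq_sym setUC. Qed.

Lemma color_rel_irr N (c : coloring N) b : irreflexive (color_rel c b).
Proof. by move=> x; rewrite /color_rel eqxx. Qed.

Definition color_class (N : nat) (c : coloring N) (b : bool) :
    ordered_graph N :=
  OrderedGraph (color_rel_sym c b) (color_rel_irr c b).

Definition arrows (n : nat) (G : ordered_graph n) (N : nat) : bool :=
  [forall c : coloring N, [exists b : bool, contains G (color_class c b)]].

Lemma ramsey_seq (T : eqType) (r : rel T) p q (s : seq T) :
  2 ^ (p + q) <= size s ->
  (exists t, [/\ subseq t s, size t = p & pairwise r t]) \/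
  (exists t, [/\ subseq t s, size t = q & pairwise (fun x y => ~~ r x y) t]).
Proof.
move En: (p + q) => n; elim: n p q s En => [|n IHn] [|p] [|q] s // En Hs.
- by left; exists [::]; rewrite sub0seq.
- by left; exists [::]; rewrite sub0seq.
- by right; exists [::]; rewrite sub0seq.
case: s Hs => [|x s] /=; first by rewrite leqn0 expn_eq0.
rewrite expnS mul2n -addnn => Hs.
have cons_sub (a : pred T) t : subseq t (filter a s) ->
    subseq (x :: t) (x :: s) /\ all a t.
  rewrite subseq_filter => /andP[at_ ts]; split=> //=; by rewrite eqxx.
have [le|lt] := leqP (2 ^ n) (count (r x) s).
  have En' : p + q.+1 = n by move: En; rewrite addSn => -[].
  rewrite -size_filter in le.
  case: (IHn _ _ _ En' le) => -[t [ts tz tp]].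
    have [sub al] := cons_sub _ _ ts.
    by left; exists (x :: t); rewrite /= tz tp al.
  right; exists t; split=> //.
  exact: subseq_trans ts (subseq_trans (filter_subseq _ _) (subseq_cons _ _)).
have le : 2 ^ n <= count (predC (r x)) s.
  rewrite -(leq_add2l (2 ^ n)) (leq_trans Hs) // -(count_predC (r x) s).
  by rewrite -addSn leq_add2r.
have En' : p.+1 + q = n by move: En; rewrite addnS => -[].
rewrite -size_filter in le.
case: (IHn _ _ _ En' le) => -[t [ts tz tp]].
  left; exists t; split=> //.
  exact: subseq_trans ts (subseq_trans (filter_subseq _ _) (subseq_cons _ _)).
have [sub al] := cons_sub _ _ ts.
right; exists (x :: t); split; rewrite /= ?tz // tp andbT.
exact: al.
Qed.

Lemma arrows_ex (n : nat) (G : ordered_graph n) : exists N, arrows G N.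
Proof.
exists (2 ^ (n + n)); set N := 2 ^ (n + n); apply/forallP=> c.
have [t [b [ts tz tp]]] : exists t b, [/\ subseq t (enum 'I_N), size t = n
    & pairwise (fun x y => c [set x; y] == b) t].
  have := @ramsey_seq _ (fun x y => c [set x; y]) n n (enum 'I_N).
  rewrite size_enum_ord => /(_ (leqnn _)) [] [t [ts tz tp]].
    exists t, true; split=> //.
    by apply: sub_pairwise tp => x y /= ->.
  exists t, false; split=> //.
  by apply: sub_pairwise tp => x y /= /negbTE ->.
apply/existsP; exists b.
have t_sorted : sorted ltn (map val t).
  apply: subseq_sorted (map_subseq val ts) _; first exact: ltn_trans.
  by rewrite val_enum_ord iota_ltn_sorted.
have x0 : 'I_N by apply: (@Ordinal N 0); rewrite expn_gt0.
pose f := [ffun i : 'I_n => nth x0 t i].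
have f_lt (x y : 'I_n) : x < y -> f x < f y.
  move=> xy; rewrite !ffunE -!(nth_map x0 0 val) ?tz //.
  by apply: (sorted_ltn_nth ltn_trans) => //; rewrite inE size_map tz.
have f_col (x y : 'I_n) : x < y -> c [set f x; f y] == b.
  move=> xy; rewrite !ffunE.
  by move/(pairwiseP x0): tp; apply; rewrite ?inE ?tz.
have f_neq (x y : 'I_n) : x < y -> f x != f y.
  by move=> /f_lt; rewrite ltn_neqAle => /andP[].
apply/existsP; exists f; apply/and3P; split.
- apply/injectiveP=> x y fxy; apply/val_inj.
  by case: (ltngtP x y) => // /f_neq; rewrite fxy eqxx.
- apply/forallP=> x; apply/forallP=> y; apply/implyP.
  by rewrite leq_eqVlt => /orP[/eqP/val_inj->|/f_lt/ltnW].
- apply/forallP=> x; apply/forallP=> y; apply/implyP=> exy.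
  rewrite /= /color_rel; case: (ltngtP x y) => [xy|yx|/val_inj xy].
  + by rewrite f_neq ?f_col.
  + by rewrite eq_sym setUC f_neq ?f_col.
  + by rewrite xy edge_irr in exy.
Qed.

Definition ordered_ramsey (n : nat) (G : ordered_graph n) : nat :=
  ex_minn (arrows_ex G).

(* The u_i are the vertices lshift b i and the w_j the vertices rshift a j. *)
Definition matrix_graph_rel (a b : nat) (P : 'M[bool]_(a, b)) :
    rel 'I_(a + b) :=
  fun x y => match split x, split y with
    | inl i, inr j => P i j
    | inr j, inl i => P i j
    | _, _ => false
    end.

Lemma matrix_graph_sym a b (P : 'M[bool]_(a, b)) :
  symmetric (matrix_graph_rel P).
Proof.
by move=> x y; rewrite /matrix_graph_rel; case: (split x) (split y) => ? [].
Qed.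

Lemma matrix_graph_irr a b (P : 'M[bool]_(a, b)) :
  irreflexive (matrix_graph_rel P).
Proof. by move=> x; rewrite /matrix_graph_rel; case: (split x). Qed.

Definition matrix_graph (a b : nat) (P : 'M[bool]_(a, b)) :
    ordered_graph (a + b) :=
  OrderedGraph (matrix_graph_sym P) (matrix_graph_irr P).

(* The cast only turns the row count c + a of the block matrix into a + c, so
   that direct sums of square matrices are again square. *)
Definition direct_sum (a b c d : nat) (A : 'M[bool]_(a, b))
    (B : 'M[bool]_(c, d)) : 'M[bool]_(a + c, b + d) :=
  castmx (addnC c a, erefl (b + d))
    (block_mx (0 : 'M_(c, b))%R B A (0 : 'M_(a, d))%R).

(* P_1 (+) (P_2 (+) ...), the empty sum being the 0 x 0 matrix; m.+1 * k is
   convertible to k + m * k. *)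
Fixpoint direct_sums (k m : nat) : ('I_m -> 'M[bool]_k) -> 'M[bool]_(m * k) :=
  match m with
  | 0 => fun _ => 0%R
  | m'.+1 => fun Q =>
      direct_sum (Q ord0) (direct_sums (fun i : 'I_m' => Q (lift ord0 i)))
  end.

(* Main.v *)
Require Import Defs.
From mathcomp Require Import all_boot all_order all_fingroup all_algebra.

Set Implicit Arguments.
Unset Strict Implicit.
Unset Printing Implicit Defensive.

(** The blocks of a direct sum are nested in the ordered graph: the rows of the
    first block are the last of the [u]s and its columns the first of the [w]s,
    so each block lies between the two halves of the next one.  Cut the vertex
    set into a left part consisting of [2m] intervals of length [2k] and a right
    part consisting of [2m] intervals of length [k * 4 ^ k], and pair the
    intervals from the middle outwards, so that the pairs are nested like the
    blocks.  Between the two intervals of a pair, a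
    2-coloring contains a monochromatic complete bipartite graph with [k]
    vertices on each side ([mono_biclique]), which hosts every [k * k] matrix.
    Among the [2m] pairs, [m] get the same color, and these host the blocks of
    the direct sum one by one ([mono_direct_sums]).  The number of vertices is
    [2m * (2k + k * 4 ^ k)], at most [2 ^ (5k) * m]. *)

(** An ordered copy of the bipartite graph of [P] when [S ++ U] is increasing.
    Subsequences keep the order implicit and let copies be put side by side by
    concatenation. *)
Definition hosts (T : eqType) (x0 : T) (r : rel T) (S U : seq T) (a b : nat)
    (P : 'M[bool]_(a, b)) : Prop :=
  exists s u, [/\ subseq s S, subseq u U, size s = a, size u = b
    & forall i j, P i j -> r (nth x0 s i) (nth x0 u j)].

Lemma hosts_sub (T : eqType) (x0 : T) (r : rel T) (S S' U U' : seq T) a b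
    (P : 'M[bool]_(a, b)) :
  subseq S S' -> subseq U U' -> hosts x0 r S U P -> hosts x0 r S' U' P.
Proof.
move=> SS UU [s [u [sS uU zs zu su]]]; exists s, u; split=> //.
  exact: subseq_trans sS SS.
exact: subseq_trans uU UU.
Qed.

(** The concatenations are in opposite orders because [A] is the lower left
    block of the direct sum. *)
Lemma hosts_direct_sum (T : eqType) (x0 : T) (r : rel T)
    (S1 U1 S2 U2 : seq T) a b c d (A : 'M[bool]_(a, b)) (B : 'M[bool]_(c, d)) :
  hosts x0 r S1 U1 A -> hosts x0 r S2 U2 B ->
  hosts x0 r (S2 ++ S1) (U1 ++ U2) (direct_sum A B).
Proof.
move=> [s1 [u1 [sS1 uU1 zs1 zu1 su1]]] [s2 [u2 [sS2 uU2 zs2 zu2 su2]]].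
exists (s2 ++ s1), (u1 ++ u2); split; rewrite ?cat_subseq ?size_cat //.
- by rewrite zs2 zs1 addnC.
- by rewrite zu1 zu2.
move=> i j; rewrite /direct_sum castmxE cast_ord_id !nth_cat zs2 zu1.
have -> : i = cast_ord (esym (addnC c a)) i :> nat by [].
case: (split_ordP (cast_ord (esym (addnC c a)) i)) => i' ->;
  case: (split_ordP j) => j' ->;
  rewrite ?(block_mxEul, block_mxEur, block_mxEdl, block_mxEdr) ?mxE //=.
- by rewrite addKn => /su2.
by rewrite addKn => /su1.
Qed.

Lemma pigeonhole_count (T : Type) (V : finType) (g : T -> V) n (U : seq T) :
  n * #|V| < size U -> exists v, n < count (fun y => g y == v) U.
Proof.
move=> lt; apply/existsP; apply: contraLR lt => /existsPn no.
have -> : size U = \sum_v count (fun y => g y == v) U.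
  rewrite -sum1_size (partition_big g predT) //=.
  by apply: eq_bigr => v _; rewrite sum1_count.
rewrite -leqNgt mulnC -sum_nat_const; apply: leq_sum => v _.
by rewrite leqNgt no.
Qed.

(** Restrict the left side to [2k] vertices: their colors towards a vertex of
    the right side form one of [4 ^ k] vectors, and some [k] vertices of the
    right side share theirs.  The majority color of that vector appears on [k]
    of the [2k] left vertices. *)
Lemma mono_biclique (T : eqType) (r : rel T) k (S U : seq T) :
  0 < k -> 2 * k <= size S -> k * 4 ^ k <= size U ->
  exists c s u, [/\ subseq s S, subseq u U, size s = k, size u = k
    & {in s & u, forall x y, r x y == c}].
Proof.
move=> k0 leS leU; set S' := take (2 * k) S.
have zS' : size S' = 2 * k by rewrite size_takel.
pose g y := tcast zS' (map_tuple (r^~ y) (in_tuple S')).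
have [v /= lev] : exists v, k.-1 < count (fun y => g y == v) U.
  apply: pigeonhole_count; apply: leq_trans leU.
  rewrite card_tuple card_bool expnM ltn_pmul2r ?expn_gt0 //.
  by rewrite prednK.
rewrite prednK // -size_filter in lev.
set U' := filter _ U in lev.
case EU : U' => [|y0 U'']; first by rewrite EU leqNgt k0 in lev.
have gv y : y \in U' -> g y = v by rewrite mem_filter => /andP[/eqP].
have rE x y : x \in S' -> y \in U' -> r x y = r x y0.
  move=> xS yU; have : g y = g y0 by rewrite !gv // EU mem_head.
  by move/(congr1 (@tval _ _)); rewrite !val_tcast => /eq_in_map; apply.
have [c lec] : exists c, k <= count (fun x => r x y0 == c) S'.
  have [le|lt] := leqP k (count (fun x => r x y0 == true) S').
    by exists true.
  exists false; rewrite -(leq_add2l k) addnn -mul2n -zS'.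
  rewrite -(count_predC (fun x => r x y0 == true)).
  rewrite leq_add ?(ltnW lt) //; apply: sub_count => x /=.
  by case: (r x y0).
rewrite -size_filter in lec.
exists c, (take k [seq x <- S' | r x y0 == c]), (take k U').
rewrite !size_takel //; split=> //.
- apply: subseq_trans (take_subseq _ _) _.
  exact: subseq_trans (filter_subseq _ _) (take_subseq _ _).
- exact: subseq_trans (take_subseq _ _) (filter_subseq _ _).
move=> x y /mem_take; rewrite mem_filter => /andP[/eqP <- xS] /mem_take yU.
by rewrite (rE x y).
Qed.

(** The first block of a direct sum is the innermost one, so the induction
    takes the intervals at the interface of [S] and [U] for it and leaves the
    outer intervals to the remaining blocks.  Since a biclique hosts any block,
    only the numbers [p] and [q] of blocks that the two colors still lack have
    to be recorded; the innermost pair lowers one of them. *)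
Lemma mono_direct_sums (T : eqType) (x0 : T) (r : rel T) k p q (S U : seq T) :
  0 < k -> (p + q) * (2 * k) <= size S -> (p + q) * (k * 4 ^ k) <= size U ->
  (forall Q : 'I_p -> 'M[bool]_k,
     hosts x0 (fun x y => r x y == true) S U (direct_sums Q)) \/
  (forall Q : 'I_q -> 'M[bool]_k,
     hosts x0 (fun x y => r x y == false) S U (direct_sums Q)).
Proof.
move=> k0; move En: (p + q) => n.
have empty c (Q : 'I_0 -> 'M[bool]_k) S' U' :
    hosts x0 (fun x y => r x y == c) S' U' (direct_sums Q).
  by exists [::], [::]; split; rewrite ?sub0seq // => -[].
elim: n p q S U En => [|n IHn] [|p] [|q] S U // En; try by [left|right].
rewrite !mulSn => leS leU.
set i := size S - 2 * k; set j := k * 4 ^ k.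
have zS1 : size (take i S) = i by rewrite size_takel ?leq_subr.
have leS1 : n * (2 * k) <= size (take i S).
  by rewrite zS1 leq_subRL ?(leq_trans _ leS) ?leq_addr.
have leU1 : n * j <= size (drop j U).
  by rewrite size_drop leq_subRL ?(leq_trans _ leU) ?leq_addr.
have leS2 : 2 * k <= size (drop i S).
  by rewrite size_drop subKn ?(leq_trans _ leS) ?leq_addr.
have leU2 : j <= size (take j U).
  by rewrite size_takel ?(leq_trans _ leU) ?leq_addr.
have [c [s [u [sS uU zs zu su]]]] := mono_biclique r k0 leS2 leU2.
have inner (Q : 'M[bool]_k) :
    hosts x0 (fun x y => r x y == c) (drop i S) (take j U) Q.
  by exists s, u; split=> // a b _; apply: su; apply: mem_nth; rewrite ?zs ?zu.
have widen c' a b (M : 'M[bool]_(a, b)) :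
    hosts x0 (fun x y => r x y == c') (take i S) (drop j U) M ->
    hosts x0 (fun x y => r x y == c') S U M.
  by apply: hosts_sub; rewrite ?take_subseq ?drop_subseq.
have extend l :
    (forall Q : 'I_l -> 'M[bool]_k, hosts x0 (fun x y => r x y == c)
       (take i S) (drop j U) (direct_sums Q)) ->
    forall Q : 'I_l.+1 -> 'M[bool]_k,
      hosts x0 (fun x y => r x y == c) S U (direct_sums Q).
  move=> outer Q; rewrite -(cat_take_drop i S) -(cat_take_drop j U).
  exact: hosts_direct_sum (inner _) (outer _).
case: c {su} inner extend => inner extend.
- have En' : p + q.+1 = n by move: En; rewrite addSn => -[].
  case: (IHn _ _ _ _ En' leS1 leU1) => outer; first by left; apply: extend.
  by right=> Q; apply: widen.
- have En' : p.+1 + q = n by move: En; rewrite addnS => -[].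
  case: (IHn _ _ _ _ En' leS1 leU1) => outer; last by right; apply: extend.
  by left=> Q; apply: widen.
Qed.

Lemma hosts_contains N (c : coloring N) (x0 : 'I_N) b (S U : seq 'I_N) n1 n2
    (P : 'M[bool]_(n1, n2)) :
  S ++ U = enum 'I_N ->
  hosts x0 (fun x y => c [set x; y] == b) S U P ->
  contains (matrix_graph P) (color_class c b).
Proof.
move=> SU [s [u [sS uU zs zu su]]].
have zsu : size (s ++ u) = n1 + n2 by rewrite size_cat zs zu.
have sorted_su : sorted ltn (map val (s ++ u)).
  apply: subseq_sorted (map_subseq val (cat_subseq sS uU)) _.
    exact: ltn_trans.
  by rewrite SU val_enum_ord iota_ltn_sorted.
pose f := [ffun i : 'I_(n1 + n2) => nth x0 (s ++ u) i].
have f_lt (x y : 'I_(n1 + n2)) : x < y -> f x < f y.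
  move=> xy; rewrite !ffunE -!(nth_map x0 0 val) ?zsu //.
  by apply: (sorted_ltn_nth ltn_trans) => //; rewrite inE size_map zsu.
have f_inj : injective f.
  move=> x y fxy; apply/val_inj.
  by case: (ltngtP x y) => // /f_lt; rewrite fxy ltnn.
apply/existsP; exists f; apply/and3P; split; first exact/injectiveP.
- apply/forallP=> x; apply/forallP=> y; apply/implyP.
  by rewrite leq_eqVlt => /orP[/eqP/val_inj->|/f_lt/ltnW].
apply/forallP=> x; apply/forallP=> y; apply/implyP=> exy.
rewrite /= /color_rel (inj_eq f_inj); apply/andP; split.
  by apply: contraL exy => /eqP->; rewrite edge_irr.
move: exy; rewrite /= /matrix_graph_rel !ffunE !nth_cat zs.
case: splitP => i xi; case: splitP => j yj //.
- by rewrite xi yj addKn => /su.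
- by rewrite xi yj addKn setUC => /su.
Qed.

Lemma host_size_bound k m :
  0 < k -> (m + m) * (2 * k) + (m + m) * (k * 4 ^ k) <= 2 ^ (5 * k) * m.
Proof.
move=> k0; rewrite -mulnDr addnn -mul2n mulnAC leq_mul //.
have le4 : 4 <= 4 ^ k by apply: (@leq_trans (4 ^ 1)); rewrite ?leq_exp2l.
have -> : 2 ^ (5 * k) = 4 ^ k * (2 ^ k * 4 ^ k).
  by rewrite -[4]/(2 ^ 2) -expnM -!expnD -mulSn -mulnDl.
have lek : k * 4 ^ k <= 2 ^ k * 4 ^ k by rewrite leq_mul // ltnW // ltn_expl.
apply: leq_trans (leq_mul le4 lek).
rewrite -[X in _ <= X * _]/(2 * 2) -mulnA leq_mul2l /= [in leqRHS]mul2n -addnn.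
by rewrite leq_add2r mulnC leq_mul2l (leq_trans _ le4) ?orbT.
Qed.

Theorem proposition20 :
  exists C : nat,
    forall (k m : nat), 0 < k -> 0 < m ->
    forall (P : 'M[bool]_(m * k)) (Q : 'I_m -> 'M[bool]_k),
      is_perm_mx P ->
      (forall i : 'I_m, is_perm_mx (Q i)) ->
      P = direct_sums Q ->
      ordered_ramsey (matrix_graph P) <= 2 ^ (C * k) * m.
Proof.
exists 5 => k m k0 m0 P Q _ _ ->.
set l := (m + m) * (2 * k); set l' := (m + m) * (k * 4 ^ k).
have l0 : 0 < l by rewrite !muln_gt0 addn_gt0 m0 k0.
rewrite /ordered_ramsey; case: ex_minnP => N _ /(_ (l + l')) le.
apply: leq_trans (host_size_bound m k0); rewrite -/l -/l'.
apply: le; apply/forallP => c.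
have x0 : 'I_(l + l') by apply: (@Ordinal _ 0); rewrite addn_gt0 l0.
have zE : size (enum 'I_(l + l')) = l + l' by rewrite size_enum_ord.
have leS : l <= size (take l (enum 'I_(l + l'))).
  by rewrite size_takel // zE leq_addr.
have leU : l' <= size (drop l (enum 'I_(l + l'))).
  by rewrite size_drop zE addKn.
by case: (mono_direct_sums x0 (fun x y => c [set x; y]) k0 leS leU) => h;
  apply/existsP; [exists true|exists false];
  apply: hosts_contains (cat_take_drop l _) (h Q).
Qed.
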